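(* Let $\alpha>0$ and let $X_1,\dots,X_n$ be iid with the Pareto distribution $F(x)=1-x^{-\alpha}$, $x>1$, with order statistics $X_{1:n}\le\dots\le X_{n:n}$. Then, as $n\to\infty$, $$\Bigl\{\Bigl(-\log\bigl(1-\tfrac{i}{n+1}\bigr),\ \log X_{i:n}\Bigr): 1\le i\le n\Bigr\}\ \longrightarrow\ \Bigl\{\bigl(x,\tfrac{x}{\alpha}\bigr): 0\le x<\infty\Bigr\}$$ in probability in $\mathcal{F}_2$.
   Context: $\mathcal{F}_2$ is the space of all closed subsets of $\mathbb{R}^2$ with the Fell topology, whose sub-base consists of the families $\{A \text{ closed}: A\cap K=\emptyset\}$ for $K$ compact and $\{A\text{ closed}: A\cap G\ne\emptyset\}$ for $G$ open. This topology is metrizable; random closed sets $A_n$ converge in probability to a closed set $A$ in $\mathcal{F}_2$ if $d_{\mathcal F}(A_n,A)\to0$ in probability, where $d_{\mathcal F}$ is a metric on $\mathcal{F}_2$ compatible with the Fell topology. *)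

(* Defs.v *)
From HB Require Import structures.
From mathcomp Require Import all_boot all_order all_algebra finmap.
From mathcomp Require Import all_classical all_reals all_analysis.

Set Implicit Arguments.
Unset Strict Implicit.
Unset Printing Implicit Defensive.

Import Order.TTheory GRing.Theory Num.Theory.
Import numFieldNormedType.Exports.

Local Open Scope classical_set_scope.
Local Open Scope ring_scope.

(* The hyperspace of closed subsets of T, the empty set included. *)
Definition fell (T : topologicalType) := {A : set T | closed A}.

HB.instance Definition _ (T : topologicalType) := gen_eqMixin (fell T).
HB.instance Definition _ (T : topologicalType) := gen_choiceMixin (fell T).

Definition fell_subbase (T : topologicalType) : set (set (fell T)) :=
  [set [set A : fell T | sval A `&` K = set0] | K in @compact T] `|`
  [set [set A : fell T | sval A `&` G !=set0] | G in @open T].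

HB.instance Definition _ (T : topologicalType) :=
  isSubBaseTopological.Build (fell T) (@fell_subbase T) id.

Definition compatible_metric (R : realType) (T : topologicalType)
    (d : T -> T -> R) : Prop :=
  [/\ forall x y, d x y = 0 <-> x = y,
      forall x y, d x y = d y x,
      forall x y z, d x z <= d x y + d y z &
      forall x, nbhs x =
        filter_from [set e : R | 0 < e] (fun e => [set y | d x y < e])].

(* Borel measurability with respect to the Fell topology. *)
Definition random_closed_set (d : measure_display) (Omega : measurableType d)
    (T : topologicalType) (A : Omega -> fell T) : Prop :=
  forall U : set (fell T), open U -> measurable (A @^-1` U).

Definition cvg_in_probability (d : measure_display) (Omega : measurableType d)
    (R : realType) (P : probability Omega R) (T : Type) (dist : T -> T -> R)
    (A : nat -> Omega -> T) (a : T) : Prop :=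
  forall eps : R, 0 < eps ->
    P [set w | eps < dist (A n w) a] @[n --> \oo] --> (0 : \bar R)%E.

(* Mutual independence: the product rule over every finite subfamily. *)
Definition mutually_independent (d : measure_display)
    (Omega : measurableType d) (R : realType) (P : probability Omega R)
    (I : choiceType) (X : I -> {RV P >-> R}) : Prop :=
  forall (J : {fset I}) (B : I -> set R),
    (forall i, measurable (B i)) ->
    P (\bigcap_(i in [set` J]) (X i @^-1` B i)) =
    (\prod_(i <- J) P (X i @^-1` B i))%E.

Definition pareto_cdf (R : realType) (alpha x : R) : R :=
  if 1 < x then 1 - x `^ (- alpha) else 0.

Definition pareto (d : measure_display) (Omega : measurableType d)
    (R : realType) (P : probability Omega R) (alpha : R)
    (X : {RV P >-> R}) : Prop :=
  forall x : R, cdf X x = (pareto_cdf alpha x)%:E.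

(* The sample of size n is (X 0 w, ..., X n.-1 w); the index i of the order
   statistic X_{i:n} runs over 1 <= i <= n. *)
Definition order_stat (R : realType) (Omega : Type) (X : nat -> Omega -> R)
    (n i : nat) (w : Omega) : R :=
  nth 0 (sort <=%R [seq X j w | j <- iota 0 n]) i.-1.

(* [ln] is 0 on nonpositive reals; under a Pareto law such sample values have
   probability 0. *)
Definition qq_points (R : realType) (Omega : Type) (X : nat -> Omega -> R)
    (n : nat) (w : Omega) : set (R * R) :=
  [set (- ln (1 - i%:R / n.+1%:R), ln (order_stat X n i w))
    | i in [set i | (1 <= i <= n)%N]].

Lemma closed_qq_points (R : realType) (Omega : Type) (X : nat -> Omega -> R)
    (n : nat) (w : Omega) : closed (qq_points X n w).
Proof.
apply: (accessible_finite_set_closed.1 (hausdorff_accessible _)).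
  exact: norm_hausdorff.
apply: finite_image; apply: (@sub_finite_set _ _ `I_n.+1) => // i /= /andP[_].
by rewrite ltnS.
Qed.

Definition qq_plot (R : realType) (Omega : Type) (X : nat -> Omega -> R)
    (n : nat) (w : Omega) : fell (R * R)%type :=
  exist _ (qq_points X n w) (@closed_qq_points R Omega X n w).

Definition half_line (R : realType) (alpha : R) : set (R * R) :=
  [set (x, x / alpha) | x in [set x : R | 0 <= x]].

Lemma closed_half_line (R : realType) (alpha : R) : closed (half_line alpha).
Proof.
have -> : half_line alpha =
    [set p | 0 <= p.1] `&` [set p | p.2 - p.1 / alpha = 0].
  apply/seteqP; split => [_ [x x0 <-]|[x y] /= [x0 /eqP]].
    by split => //=; rewrite subrr.
  by rewrite subr_eq0 => /eqP ->; exists x.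
apply: closedI.
  apply: (@preimage_closed _ _ (fun p : R * R => p.1) [set x : R | 0 <= x]).
    by move=> p _; exact: cvg_fst.
  exact: closed_ge.
apply: (@preimage_closed _ _ (fun p : R * R => p.2 - p.1 / alpha) [set x : R | x = 0]).
  move=> p _; apply: cvgB; first exact: cvg_snd.
  by apply: cvgMr_tmp; exact: cvg_fst.
exact: closed_eq.
Qed.

Definition limit_line (R : realType) (alpha : R) : fell (R * R)%type :=
  exist _ (half_line alpha) (@closed_half_line R alpha).

(* Main.v *)
From HB Require Import structures.
Require Import Defs.
From mathcomp Require Import all_boot all_order all_algebra finmap.
From mathcomp Require Import all_classical all_reals all_analysis.
From mathcomp Require Import measurable_realfun ring lra.

Set Implicit Arguments.
Unset Strict Implicit.
Unset Printing Implicit Defensive.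

Import Order.TTheory GRing.Theory Num.Theory.
Import numFieldNormedType.Exports.

Local Open Scope classical_set_scope.
Local Open Scope ring_scope.

(** Write c_i = - ln (1 - i/(n+1)) for the plotting positions and Y_i for the
    logarithm of the i-th order statistic. The proof rests on the filter
    [whp P] on pairs (n, w): it consists of the statements B (n, w) whose
    failure set at stage n is contained in a measurable set of probability
    tending to 0. Convergence in probability is convergence along this filter,
    so a finite conjunction of statements that hold with high probability
    holds with high probability, and topological arguments apply verbatim.

    Convergence to A in the Fell topology along any filter follows from two
    local conditions ([fell_cvg]): near a point outside A the sets have
    eventually no point, and every neighbourhood of a point of A is eventually
    hit. Compactness, as the near-covering property, turns the first condition
    into the avoidance of a compact set.

    Both conditions reduce to a comparison on quadrants, which says that the
    points stay close to the line. For t > 0 the point (c_i, Y_i) satisfies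
    c_i < s exactly when i < (n+1)(1 - exp (-s)), and Y_i <= t exactly when at
    least i sample values are at most exp t; by the weak law of large numbers
    ([whp_frequency], from Chebyshev's inequality) the number of these values
    is n (1 - exp (- alpha t)) up to o(n) in probability. Hence if
    s < alpha t then with high probability c_i < s forces Y_i <= t
    ([whp_qq_below]), and if alpha t < s then s < c_i forces t <= Y_i
    ([whp_qq_above]); in the latter the case t <= 0 is clear, since almost
    surely every sample value exceeds 1. Plotting positions become dense in
    the half-line ([plotting_position_dense]), so every neighbourhood of a
    point of the line is hit.

    That the plot is a random closed set holds because a finite set depends
    continuously on its points ([fell_cvg_range]) and an open set of R^n is a
    countable union of rational boxes; the order statistics are measurable
    since their distribution events are events about counts. *)

(** * Convergence in the Fell topology *)

(** A criterion for convergence in the Fell topology along a filter. The first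
    hypothesis is local, about single points outside the limit; compactness
    makes it uniform. *)
Lemma fell_cvg (T : topologicalType) (I : Type) (F : set_system I)
    (f : I -> fell T) (A : fell T) :
  Filter F ->
  (forall p, ~ sval A p -> \forall q \near p & i \near F, ~ sval (f i) q) ->
  (forall p V, sval A p -> nbhs p V ->
     \forall i \near F, sval (f i) `&` V !=set0) ->
  f @ F --> A.
Proof.
move=> FF miss hit U [X [[/= B sB <-] [W BW WA] XU]].
have [E sE EW] := sB W BW.
apply: (@filterS _ F _ (f @^-1` W)).
  by move=> i Wi; apply: XU; exists W.
rewrite -EW preimage_bigcap; apply: filter_bigI => S SE.
have SA : S A by rewrite -EW in WA; exact: WA.
move: SA; move/set_mem: (sE _ SE) => [[K cK <-]|[G oG <-]] SA.
(* Sub-basic sets of the first kind: the sets that miss a compact K. *)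
- have /compact_near_coveringP cov := cK.
  have miss' p : K p -> \forall q \near p & i \near F, ~ sval (f i) q.
    by move=> Kp; apply: miss => Ap; move/disjoints_subset: SA => /(_ p Ap).
  near=> i; apply/disjoints_subset => q fq Kq.
  by move: fq; apply: (near (cov _ _ _ FF miss') i).
(* Sub-basic sets of the second kind: the sets that hit an open G. *)
- have [p [Ap Gp]] := SA.
  exact: (hit p G Ap (open_nbhs_nbhs (conj oG Gp))).
Unshelve. all: by end_near. Qed.

Lemma fell_inj (T : topologicalType) (A B : fell T) : sval A = sval B -> A = B.
Proof.
case: A B => [A cA] [B cB] /= AB; rewrite -AB in cB *.
by congr exist; exact: Prop_irrelevance.
Qed.

(** A finite set depends continuously on its points. *)
Lemma fell_cvg_range (T : topologicalType) (J : finType) (I : Type)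
    (F : set_system I) (g : I -> J -> T) (a : J -> T) (f : I -> fell T)
    (A : fell T) : Filter F -> hausdorff_space T ->
  (forall j, g i j @[i --> F] --> a j) ->
  (forall i, sval (f i) = range (g i)) -> sval A = range a ->
  f @ F --> A.
Proof.
move=> FF hT ga fg Aa; apply: fell_cvg.
- move=> p; rewrite Aa => pa.
  have gp j : filter_prod (nbhs p) F [set qi | g qi.2 j <> qi.1].
    have /eqP apj : a j <> p by move=> ajp; apply: pa; exists j.
    move: (hT); rewrite open_hausdorff => /(_ _ _ apj)
      [[/= V W] [Vaj Wp] [oV oW VW0]].
    have gV : \forall i \near F, V (g i j).
      by apply: ga; apply: open_nbhs_nbhs; split => //; exact/set_mem.
    exists (W, [set i | V (g i j)]) => /=.
      by split => //; apply: open_nbhs_nbhs; split => //; exact/set_mem.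
    move=> [q i] /= [Wq Vg] gq; move/eqP/disjoints_subset: VW0.
    move=> /(_ q); apply; last exact: Wq.
    by rewrite -gq.
  suff : filter_prod (nbhs p) F [set qi | ~ sval (f qi.2) qi.1] by [].
  apply: filterS (filter_forall _ gp).
  by move=> -[q i] /= gq; rewrite fg => -[j _] /gq.
- move=> p V; rewrite Aa => -[j _ <-] Vaj.
  have gV : \forall i \near F, V (g i j) by exact: ga.
  apply: filterS gV => i Vg; exists (g i j); split => //.
  by rewrite fg; exists j.
Qed.

(** * Measurability of the plot *)

Section measurability.
Context d (Omega : measurableType d) (R : realType).

Lemma count_measurable (A : nat -> Omega -> bool) (s : seq nat) (k : nat) :
  (forall j, measurable [set w | A j w]) ->
  measurable [set w | (k <= count (A ^~ w) s)%N].
Proof.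
move=> mA; elim: s k => [|j s IH] [|k] /=.
- by rewrite (_ : [set _ | _] = setT)//; apply/seteqP; split.
- by rewrite (_ : [set _ | _] = set0)//; apply/seteqP; split.
- by rewrite (_ : [set _ | _] = setT)//; apply/seteqP; split.
- rewrite (_ : [set _ | _] =
    ([set w | A j w] `&` [set w | (k <= count (A ^~ w) s)%N]) `|`
    [set w | (k < count (A ^~ w) s)%N]); first by
    apply: measurableU => //; exact: measurableI.
  apply/seteqP; split => w /=; case: (A j w) => /=.
  + by rewrite add1n ltnS; left.
  + by rewrite add0n; right.
  + by rewrite add1n ltnS => -[[]//|/ltnW].
  + by rewrite add0n => -[[]|].
Qed.

Lemma nth_sort_le (s : seq R) (i : nat) (u : R) : (i < size s)%N ->
  (nth 0 (sort <=%R s) i <= u) = (i < count (fun x => (x <= u)%R) s)%N.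
Proof.
move=> si.
have ss : sorted <=%R (sort <=%R s) by exact: sort_le_sorted.
have -> : count (fun x => (x <= u)%R) s = count (<= u) (sort <=%R s).
  by apply/permP; rewrite perm_sym; apply/permPl; exact: perm_sort.
case: ltnP => [|h]; first exact: Order.POrderTheory.nth_count_le.
apply/negbTE; rewrite -ltNge; apply: nth_count_gt => //.
by rewrite h size_sort.
Qed.

(** The i-th order statistic is at most u if and only if at least i sample
    values are at most u. *)
Lemma order_stat_le (X : nat -> Omega -> R) (n i : nat) (w : Omega) (u : R) :
  (1 <= i <= n)%N ->
  (order_stat X n i w <= u) =
  (i <= count (fun j => (X j w <= u)%R) (iota 0 n))%N.
Proof.
move=> /andP[i1 ni].
by rewrite /order_stat nth_sort_le ?size_map ?size_iota ?count_map ?prednK//.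
Qed.

Lemma measurable_order_stat (X : nat -> Omega -> R) (n i : nat) :
  (1 <= i <= n)%N -> (forall j, measurable_fun setT (X j)) ->
  measurable_fun setT (order_stat X n i).
Proof.
move=> i1n mX mT.
apply: (measurability _ (RGenOInfty.measurableE R)) => //.
move=> /= _ [_ [u ->] <-]; rewrite setTI preimage_itvoy.
rewrite (_ : [set _ | _] =
    ~` [set w | i <= count (fun j => (X j w <= u)%R) (iota 0 n)]%N).
  apply: measurableC; apply: (@count_measurable (fun j w => X j w <= u)) => j.
  rewrite -[X in measurable X]setTI -preimage_itvNyc.
  by apply: mX => //; exact: measurable_itv.
by apply/seteqP; split => w /=; rewrite -order_stat_le// ltNge => /negP.
Qed.

Lemma bigcup_countType_measurable (I : countType) (F : I -> set Omega) :
  (forall i, measurable (F i)) -> measurable (\bigcup_i F i).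
Proof.
move=> mF.
rewrite (_ : \bigcup_i F i = \bigcup_n oapp F set0 (@choice.unpickle I n)).
  by apply: bigcupT_measurable => n; case: choice.unpickle => /=.
apply/seteqP; split => w [i _ Fw].
  by exists (choice.pickle i) => //; rewrite choice.pickleK.
by case: choice.unpickle Fw => //= j Fj; exists j.
Qed.

Lemma measurable_preimage_open_rV (n : nat) (Y : Omega -> 'rV[R]_n)
    (O : set 'rV[R]_n) :
  (forall i, measurable_fun setT (fun w => Y w 0 i)) -> open O ->
  measurable (Y @^-1` O).
Proof.
move=> mY oO.
(* Boxes centred at a rational point, of radius the inverse of a positive
   integer. *)
pose q2r (q : 'rV[rat]_n) : 'rV[R]_n := map_mx ratr q.
pose box (qk : 'rV[rat]_n * nat) : set 'rV[R]_n :=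
  [set y | forall i, ball (q2r qk.1 0 i) (qk.2.+1%:R^-1) (y 0 i)].
rewrite (_ : Y @^-1` O = \bigcup_(qk : 'rV[rat]_n * nat)
  if `[< box qk `<=` O >] then Y @^-1` (box qk) else set0).
  apply: bigcup_countType_measurable => qk; case: ifP => // _.
  rewrite (_ : _ @^-1` _ = \bigcap_(i in [set: 'I_n])
     [set w | ball (q2r qk.1 0 i) (qk.2.+1%:R^-1) (Y w 0 i)]); last first.
    by apply/seteqP; split => w h i; [move=> _|]; exact: h.
  apply: fin_bigcap_measurable => // i _.
  rewrite -[X in measurable X]setTI.
  by apply: mY => //; exact: measurable_ball.
apply/seteqP; split => w /=; last first.
  by move=> [qk _]; case: ifP => // /asboolP bO Yw; exact: bO.
move=> OY.
have /nbhs_ballP[e e0 eO] : nbhs (Y w) O by exact: open_nbhs_nbhs.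
have [k _ /(_ k (leqnn k)) ke] :=
  near_infty_natSinv_lt (PosNum (divr_gt0 e0 (ltr0n R 2))).
have {}ke : k.+1%:R^-1 < e / 2 := ke.
have /choice[q qY] i : exists q : rat, ball (ratr q : R) k.+1%:R^-1 (Y w 0 i).
  have /rat_in_itvoo[q] : Y w 0 i - k.+1%:R^-1 < Y w 0 i + k.+1%:R^-1.
    by rewrite ltrBlDr -addrA ltrDl addr_gt0.
  rewrite in_itv/= => /andP[q1 q2]; exists q.
  by rewrite /ball/= ltr_distl q1 q2.
exists (\row_i q i, k) => //.
rewrite asboolT => [i|y yq]; first by rewrite !mxE.
apply: eO; split => // i j; rewrite (ord1 i) {i}.
have /= := yq j; rewrite !mxE => yqj.
apply: le_ball (ball_triangle (ball_sym (qY j)) yqj).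
by rewrite (splitr e) lerD// ltW.
Qed.

End measurability.

Section random_qq_plot.
Context d (Omega : measurableType d) (R : realType).

Let closed_range (n : nat) (c : 'I_n -> R) (y : 'rV[R]_n) :
  closed (range (fun i => (c i, y 0 i))).
Proof.
apply: (accessible_finite_set_closed.1 (hausdorff_accessible _)).
  exact: norm_hausdorff.
exact: finite_image.
Qed.

(** The plot is the composition of the vector of logarithms of the order
    statistics with the continuous map from R^n to finite planar sets. *)
Lemma random_qq_plot (X : nat -> Omega -> R) (n : nat) :
  (forall j, measurable_fun setT (X j)) -> random_closed_set (qq_plot X n).
Proof.
move=> mX U oU.
pose c (i : 'I_n) : R := - ln (1 - i.+1%:R / n.+1%:R).
pose f (y : 'rV[R]_n) : fell (R * R)%type := exist _ _ (@closed_range _ c y).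
pose Y w : 'rV[R]_n := \row_i ln (order_stat X n i.+1 w).
have -> : qq_plot X n = f \o Y.
  apply/funext => w; apply: fell_inj; apply/seteqP; split => /= p.
    move=> [[//|i] /= ni <-]; exists (Ordinal ni) => //=.
    by rewrite /c mxE.
  by move=> [i _ <-]; exists i.+1 => /=; [exact: ltn_ord|rewrite /c mxE].
rewrite comp_preimage; apply: measurable_preimage_open_rV => [i|].
  under eq_fun do rewrite mxE.
  apply: measurableT_comp; first exact: measurable_ln.
  by apply: measurable_order_stat => //=; exact: ltn_ord.
have fc : continuous f.
  move=> y; apply: (@fell_cvg_range (R * R)%type 'I_n 'rV[R]_n (nbhs y)
    (fun z i => (c i, z 0 i)) (fun i => (c i, y 0 i)) f (f y) _) => //.
  move=> j.
  have yj : (z : 'rV[R]_n) 0 j @[z --> y] --> y 0 j by exact: coord_continuous.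
  exact: (cvg_pair (cvg_cst (c j)) yj).
by move/continuousP : fc; apply.
Qed.

End random_qq_plot.

(** * Chebyshev's inequality for frequencies *)

Section weak_law.
Context d (Omega : measurableType d) (R : realType) (P : probability Omega R).
Local Open Scope ereal_scope.

Lemma Lfun_indic (A : set Omega) (r : R) : (0 < r)%R ->
  measurable A -> (\1_A : Omega -> R) \in Lfun P r%:E.
Proof.
move=> r0 mA; rewrite inE; apply/andP; split; rewrite inE//=.
rewrite /finite_norm unlock poweR_lty//.
under eq_integral => x _.
  rewrite /= (_ : `|\1_A x| `^ r = \1_A x)%R; last first.
    by rewrite indicE; case: (x \in A);
      rewrite ?normr1 ?normr0 ?powR1 ?powR0 ?gt_eqF.
  over.
by rewrite integral_indic// setIT (le_lt_trans (probability_le1 _ _))// ltry.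
Qed.

Lemma covariance_indic (B C : set Omega) : measurable B -> measurable C ->
  covariance P \1_B \1_C = P (B `&` C) - P B * P C.
Proof.
move=> mB mC; have mBC := measurableI _ _ mB mC.
have BC : (\1_B * \1_C)%R = \1_(B `&` C) :> (Omega -> R) by rewrite indicI.
by rewrite covarianceE ?BC ?Lfun_indic// !expectation_indic.
Qed.

Variables (A : nat -> set Omega) (q : R).
Hypothesis mA : forall i, measurable (A i).
Hypothesis PA : forall i, P (A i) = q%:E.
Hypothesis PAI : forall i j, i != j -> P (A i `&` A j) = (q * q)%:E.

Let S n : Omega -> R := fun w => (\sum_(i < n) \1_(A i) w)%R.

Let SS n : S n.+1 = (S n \+ \1_(A n))%R.
Proof. by apply/funext => w; rewrite /S big_ord_recr. Qed.

Let S0 : S 0 = cst 0%R.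
Proof. by apply/funext => w; rewrite /S big_ord0. Qed.

Let S2 n : S n \in Lfun P 2%:E.
Proof.
elim: n => [|n IH]; first by rewrite S0 Lfun_cst.
by rewrite SS rpredD ?lee1n//= => ?; exact: Lfun_indic.
Qed.

Let ES n : 'E_P[S n] = (n%:R * q)%:E.
Proof.
elim: n => [|n IH]; first by rewrite S0 expectation_cst mul0r.
rewrite SS expectationD ?Lfun_indic//; last first.
  by rewrite Lfun_subset12 ?fin_num_measure.
by rewrite IH expectation_indic// PA -EFinD -natr1 mulrDl mul1r.
Qed.

Let cov0 m n : (m <= n)%N -> covariance P (S m) \1_(A n) = 0.
Proof.
elim: m => [|m IH] mn; first by rewrite S0 covariance_cst_l.
rewrite SS covarianceDl ?Lfun_indic// IH ?(ltnW mn)// add0e.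
by rewrite covariance_indic// PAI ?PA ?ltn_eqF// -EFinM subee.
Qed.

Let VS n : 'V_P[S n] = (n%:R * (q * (1 - q)))%:E.
Proof.
elim: n => [|n IH]; first by rewrite S0 variance_cst mul0r.
rewrite SS varianceD ?Lfun_indic// IH cov0// mule0 adde0.
rewrite {1}/variance covariance_indic// setIid PA -EFinM -EFinB -EFinD.
by congr EFin; rewrite -natr1; ring.
Qed.

(** Chebyshev's inequality for the number of events that occur among n events
    of probability q that are pairwise independent. *)
Lemma chebyshev_count (n : nat) (eps : R) : (0 < eps)%R -> (0 < n)%N ->
  P [set w | n%:R * eps <= `|\sum_(i < n) \1_(A i) w - n%:R * q|]%R <=
  (q * (1 - q) / (n%:R * eps ^+ 2))%:E.
Proof.
move=> e0 n0.
have mS : measurable_fun setT (S n).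
  by have := S2 n; rewrite inE => /andP[/set_mem].
pose Sm : {RV P >-> R} := HB.pack (S n) (isMeasurableFun.Build _ _ _ _ _ mS).
have n0' : (0 < n%:R :> R)%R by rewrite ltr0n.
have := @chebyshev _ _ _ P Sm (n%:R * eps)%R (mulr_gt0 n0' e0).
rewrite /= ES/= VS -EFinM => /le_trans; apply.
by rewrite lee_fin le_eqVlt; apply/orP; left; apply/eqP; field; rewrite !gt_eqF.
Qed.

End weak_law.

(** * Statements that hold with high probability *)

Section whp.
Context d (Omega : measurableType d) (R : realType) (P : probability Omega R).

(** The statements about (n, w) that hold with probability tending to 1 as n
    tends to infinity. The failure sets need not be measurable; they are only
    required to be covered by measurable sets of vanishing probability. *)
Definition whp : set_system (nat * Omega) :=
  [set B | exists C : nat -> set Omega,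
  [/\ forall n, measurable (C n),
      P (C n) @[n --> \oo] --> (0 : \bar R)%E &
      forall n, [set w | ~ B (n, w)] `<=` C n]].

Global Instance whp_filter : Filter whp.
Proof.
split.
- exists (fun=> set0); split=> //; last by move=> n w /=; apply.
  by under eq_fun do rewrite measure0; exact: cvg_cst.
- move=> B1 B2 [C1 [mC1 PC1 BC1]] [C2 [mC2 PC2 BC2]].
  exists (fun n => C1 n `|` C2 n); split.
  + by move=> n; exact: measurableU.
  + apply: (@squeeze_cvge _ _ _ _ (cst 0%E) _ (fun n => P (C1 n) + P (C2 n))%E).
    * near=> n; rewrite measure_ge0/=; exact: measureU2.
    * exact: cvg_cst.
    * by rewrite -[0%E]adde0; apply: cvgeD.
  + move=> n w /= /not_andP[/BC1|/BC2]; [by left|by right].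
- move=> B1 B2 B12 [C [mC PC BC]]; exists C; split=> // n w /= B2w.
  by apply: BC => /= B1w; apply/B2w/B12.
Unshelve. all: by end_near. Qed.

Lemma whp_eventually (Q : nat -> Prop) :
  (\forall n \near \oo, Q n) -> \forall nw \near whp, Q nw.1.
Proof.
move=> nQ; exists (fun n => if `[< Q n >] then set0 else setT); split.
- by move=> n; case: ifP.
- apply: cvg_near_cst; near=> n.
  have Qn : Q n by near: n.
  by rewrite asboolT// measure0.
- by move=> n w /= nQw; rewrite asboolF.
Unshelve. all: by end_near. Qed.

Lemma whp_negligible (C : nat -> set Omega) :
  (forall n, P.-negligible (C n)) -> \forall nw \near whp, ~ C nw.1 nw.2.
Proof.
move=> /choice[D HD].
exists D; split=> [n||n w /=]; first by have [] := HD n.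
  have -> : (fun n => P (D n)) = cst 0%E.
    by apply/funext => n /=; have [] := HD n.
  exact: cvg_cst.
by move=> /contrapT; have [_ _] := HD n; apply.
Qed.

Lemma whp_cvg0 (B : set (nat * Omega)) :
  (forall n, measurable [set w | ~ B (n, w)]) -> whp B ->
  P [set w | ~ B (n, w)] @[n --> \oo] --> (0 : \bar R)%E.
Proof.
move=> mB [C [mC PC BC]].
apply: (@squeeze_cvge _ _ _ _ (cst 0%E) _ (fun n => P (C n))) => //.
  near=> n; rewrite measure_ge0/= le_measure ?inE//.
exact: cvg_cst.
Unshelve. all: by end_near. Qed.

(** The weak law of large numbers for the frequency of pairwise independent
    events of the same probability. *)
Lemma whp_frequency (A : nat -> set Omega) (q eps : R) :
  (forall i, measurable (A i)) -> (forall i, P (A i) = q%:E) ->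
  (forall i j, i != j -> P (A i `&` A j) = (q * q)%:E) -> 0 < eps ->
  \forall nw \near whp,
    `|\sum_(i < nw.1) \1_(A i) nw.2 - nw.1%:R * q| < nw.1%:R * eps.
Proof.
move=> mA PA PAI e0.
exists (fun n => [set w | n%:R * eps <= `|\sum_(i < n) \1_(A i) w - n%:R * q|]).
split.
- move=> n; rewrite -[X in measurable X]setTI.
  apply: (@measurable_fun_ler _ _ _ setT (cst (n%:R * eps))
    (fun w => `|\sum_(i < n) \1_(A i) w - n%:R * q|)
    _ _ measurableT [set true]).
  + exact: measurable_cst.
  + apply: measurableT_comp => //; apply: measurable_funB => //.
    by apply: measurable_sum => i; exact: measurable_indic.
  + by [].
- apply: (@squeeze_cvge _ _ _ _ (cst 0%E) _
    (fun n => (q * (1 - q) / (n%:R * eps ^+ 2))%:E)).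
  + near=> n; rewrite measure_ge0/=; apply: (@chebyshev_count _ _ _ P) => //.
    by near: n; exact: nbhs_infty_gt.
  + exact: cvg_cst.
  + apply: cvg_EFin; first by near=> n.
    suff : q * (1 - q) / (n%:R * eps ^+ 2) @[n --> \oo] --> (0 : R) by [].
    under eq_fun do rewrite invfM mulrCA.
    set c := q * (1 - q) / eps ^+ 2.
    suff : n%:R^-1 * c @[n --> \oo] --> 0 * c by rewrite mul0r.
    apply: cvgMr_tmp; apply/gtr0_cvgV0; last exact: cvgr_idn.
    by near=> n; rewrite ltr0n; near: n; exact: nbhs_infty_gt.
- by move=> n w /= /negP; rewrite -leNgt.
Unshelve. all: by end_near. Qed.

End whp.

Lemma compatible_metric_open_gt (R : realType) (T : topologicalType)
    (dist : T -> T -> R) (a : T) (eps : R) :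
  compatible_metric dist -> open [set x | eps < dist x a].
Proof.
move=> [_ _ tri nb]; rewrite openE => x /= xa.
rewrite /interior nb; exists (dist x a - eps) => /=; first by rewrite subr_gt0.
by move=> y /= xy; have := tri x y a; lra.
Qed.

(** For random elements, convergence along the filter of statements that hold
    with high probability implies convergence in probability, for every metric
    compatible with the topology. *)
Lemma whp_cvg_in_probability d (Omega : measurableType d) (R : realType)
    (P : probability Omega R) (T : topologicalType) (dist : T -> T -> R)
    (A : nat -> Omega -> T) (a : T) :
  compatible_metric dist ->
  (forall n U, open U -> measurable (A n @^-1` U)) ->
  A nw.1 nw.2 @[nw --> whp P] --> a ->
  cvg_in_probability P dist A a.
Proof.
move=> distT mA Aa eps e0.
have [_ sym _ nb] := distT.
have na : nbhs a [set x | ~ (eps < dist x a)].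
  rewrite nb; exists eps => // y /= ay.
  by apply/negP; rewrite -leNgt sym ltW.
have := whp_cvg0 _ (Aa _ na).
have -> : (fun n => P [set w | ~ ~ (eps < dist (A n w) a)])
    = (fun n => P [set w | eps < dist (A n w) a]).
  by apply/funext => n; congr (P _); apply/seteqP;
    split => w /=; [exact: contrapT|move=> ? ?].
apply => n.
rewrite (_ : [set _ | _] = A n @^-1` [set x | eps < dist x a]).
  exact/mA/compatible_metric_open_gt.
by apply/seteqP; split => w /=; [exact: contrapT|move=> ? ?].
Qed.

(** * Plotting positions *)

Section plotting_positions.
Context (R : realType).
Variables (n i : nat).
Hypothesis leni : (i <= n)%N.

Let pos : 0 < 1 - i%:R / n.+1%:R :> R.
Proof. by rewrite subr_gt0 ltr_pdivrMr ?ltr0n// mul1r ltr_nat ltnS. Qed.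

Lemma plotting_position_lt (s : R) :
  (- ln (1 - i%:R / n.+1%:R) < s) = (i%:R < n.+1%:R * (1 - expR (- s))).
Proof.
rewrite ltrNl -[- s]expRK ltr_ln ?posrE ?expR_gt0//.
by rewrite ltrBrDl -ltrBrDr expRK ltr_pdivrMr ?ltr0n// mulrC.
Qed.

Lemma plotting_position_gt (s : R) :
  (s < - ln (1 - i%:R / n.+1%:R)) = (n.+1%:R * (1 - expR (- s)) < i%:R).
Proof.
rewrite ltrNr -[- s]expRK ltr_ln ?posrE ?expR_gt0//.
by rewrite ltrBlDl -ltrBlDr expRK ltr_pdivlMr ?ltr0n// mulrC.
Qed.

Lemma plotting_position_ge0 : 0 <= - ln (1 - i%:R / n.+1%:R) :> R.
Proof.
by rewrite leNgt plotting_position_lt oppr0 expR0 subrr mulr0 -leNgt ler0n.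
Qed.

End plotting_positions.

(** The witness is the least i with i > (n+1)(1 - exp (-x)). It is at most n,
    and its plotting position is less than x', as soon as
    (n+1)(exp (-x) - exp (-x')) > 1. *)
Lemma plotting_position_dense (R : realType) (x x' : R) : 0 <= x -> x < x' ->
  \forall n \near \oo, exists2 i, (1 <= i <= n)%N &
    x < - ln (1 - i%:R / n.+1%:R) < x'.
Proof.
move=> x0 xx'.
set p := 1 - expR (- x); set p' := 1 - expR (- x').
have p0 : 0 <= p by rewrite subr_ge0 -expR0 ler_expR oppr_le0.
have pp' : p < p' by rewrite ltrD2l ltrN2 ltr_expR ltrN2.
have p'1 : p' < 1 by rewrite ltrBlDr ltrDl expR_gt0.
near=> n.
have np : 1 < n.+1%:R * (p' - p).
  rewrite -ltr_pdivrMr ?subr_gt0//.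
  apply: (@lt_trans _ _ n%:R); last by rewrite ltr_nat.
  by near: n; exact: nbhs_infty_gtr.
have n0 : 0 < n.+1%:R :> R by rewrite ltr0n.
pose i := (Num.truncn (n.+1%:R * p)).+1.
have np0 : 0 <= n.+1%:R * p by rewrite mulr_ge0// ltW.
have /andP[i1 i2] := truncn_itv np0.
have ip' : i%:R < n.+1%:R * p' by rewrite /i -natr1; lra.
have lin : (i <= n)%N.
  by rewrite -ltnS -(ltr_nat R) (lt_le_trans ip')// ger_pMr// ltW.
exists i; first by rewrite lin.
by rewrite plotting_position_gt// plotting_position_lt// ip' andbT.
Unshelve. all: by end_near. Qed.

(** * The plot with high probability *)

Section qq_plot_whp.
Context d (Omega : measurableType d) (R : realType) (P : probability Omega R).
Variables (alpha : R) (X : nat -> {RV P >-> R}).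
Hypotheses (alpha0 : 0 < alpha) (indepX : mutually_independent X).
Hypothesis paretoX : forall i, pareto alpha (X i).

Lemma pareto_cdf_expR (t : R) : 0 < t ->
  pareto_cdf alpha (expR t) = 1 - expR (- (alpha * t)).
Proof.
move=> t0; rewrite /pareto_cdf -[X in X < _]expR0 ltr_expR t0.
by rewrite /powR gt_eqF ?expR_gt0// expRK mulNr mulrC.
Qed.

Lemma sum_indic_count (A : nat -> set Omega) (b : nat -> bool) (n : nat) w :
  (forall j, A j w <-> b j) ->
  \sum_(j < n) \1_(A j) w = (count b (iota 0 n))%:R :> R.
Proof.
move=> Ab; rewrite -(big_mkord xpredT (fun j => \1_(A j) w)) /index_iota subn0.
rewrite -sum1_count natr_sum [RHS]big_mkcond/=; apply: eq_bigr => j _.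
rewrite indicE; case: (boolP (b j)) => bj.
  by rewrite mem_set//; exact/Ab.
by rewrite memNset// => /Ab; exact/negP.
Qed.

(** Pointwise convergence in probability of the empirical distribution
    function. *)
Lemma whp_empirical_cdf (u eps : R) : 0 < eps ->
  \forall nw \near whp P,
    `|(count (fun j => (X j nw.2 <= u)%R) (iota 0 nw.1))%:R
      - nw.1%:R * pareto_cdf alpha u| < nw.1%:R * eps.
Proof.
move=> e0; pose A j := X j @^-1` `]-oo, u].
have mA j : measurable (A j).
  by rewrite -[X in measurable X]setTI; apply: measurable_funPT.
have PA j : P (A j) = (pareto_cdf alpha u)%:E by exact: paretoX.
have PAI i j : i != j ->
    P (A i `&` A j) = (pareto_cdf alpha u * pareto_cdf alpha u)%:E.
  move=> ij.
  have := indepX [fset i; j]%fset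
    (B := fun=> `]-oo, u]%classic) (fun=> measurable_itv _).
  rewrite big_fsetU1 ?inE// big_seq_fset1/= -/(A i) -/(A j) !PA EFinM => <-.
  congr (P _); apply/seteqP; split => w /=.
    by move=> [Ai Aj] k /=; rewrite !inE => /orP[] /eqP ->.
  by move=> h; split; apply: h; rewrite /= !inE eqxx ?orbT.
have := whp_frequency mA PA PAI e0.
apply: filterS => -[n w] /=.
by rewrite (@sum_indic_count _ (fun j => (X j w <= u)%R))// => j;
  rewrite /A/= in_itv.
Qed.

(** The statement does not depend on n and even holds almost surely. *)
Lemma whp_gt1 : \forall nw \near whp P, forall j, 1 < X j nw.2.
Proof.
have N : P.-negligible (\bigcup_j X j @^-1` `]-oo, 1]).
  apply: negligible_bigcup => j; apply/negligibleP.
    by rewrite -[X in measurable X]setTI; apply: measurable_funPT.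
  by have := paretoX j 1; rewrite /pareto_cdf ltxx.
have := whp_negligible (fun=> N); apply: filterS => -[n w] /= Xj j.
by rewrite ltNge; apply/negP => Xj1; apply: Xj; exists j; rewrite //= in_itv.
Qed.

(** With high probability no point of the plot lies in the quadrant to the left
    of s and above t, whose corner (s, t) is above the line. *)
Lemma whp_qq_below (s t : R) : s < alpha * t ->
  \forall nw \near whp P, forall i, (1 <= i <= nw.1)%N ->
    - ln (1 - i%:R / nw.1.+1%:R) < s -> ln (order_stat X nw.1 i nw.2) <= t.
Proof.
move=> st; have [s0|s0] := leP s 0.
  apply: filterE => -[n w] /= i /andP[i1 lin]; rewrite ltNge.
  by rewrite (le_trans s0)// plotting_position_ge0.
have t0 : 0 < t by rewrite -(pmulr_rgt0 _ alpha0) (lt_trans s0).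
set p := 1 - expR (- s); set q := pareto_cdf alpha (expR t).
have pq : p < q by rewrite /q pareto_cdf_expR// ltrD2l ltrN2 ltr_expR ltrN2.
have e0 : 0 < (q - p) / 2 by rewrite divr_gt0// subr_gt0.
(* absorbs the difference between the factors n.+1 and n *)
have large : \forall n \near \oo, p <= n%:R * ((q - p) / 2).
  near=> n; rewrite -ler_pdivrMr//; near: n; exact: nbhs_infty_ger.
have := whp_empirical_cdf (expR t) e0.
apply: filterS2 (whp_eventually P large) => -[n w] /= pn.
rewrite ltr_norml -/q => /andP[Nq _] i i1n.
have /andP[_ lin] := i1n; rewrite plotting_position_lt// -/p => ip.
have : order_stat X n i w <= expR t.
  rewrite order_stat_le// -(ler_nat R).
  rewrite -natr1 in ip.
  nra.
have [os0 ost|os0 _] := ltP 0 (order_stat X n i w).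
  by rewrite -[t]expRK ler_ln ?posrE ?expR_gt0.
(* [ln] is 0 at a nonpositive order statistic, and t is positive *)
by rewrite ln0// ltW.
Unshelve. all: by end_near. Qed.

(** With high probability no point of the plot lies in the quadrant to the right
    of s and below t, whose corner (s, t) is below the line. *)
Lemma whp_qq_above (s t : R) : alpha * t < s ->
  \forall nw \near whp P, forall i, (1 <= i <= nw.1)%N ->
    s < - ln (1 - i%:R / nw.1.+1%:R) -> t <= ln (order_stat X nw.1 i nw.2).
Proof.
move=> ts; have [t0|t0] := leP t 0.
  (* Frequencies alone would not exclude o(n) values below 1; the almost sure
     lower bound does. *)
  apply: filterS whp_gt1 => -[n w] /= X1 i i1n _.
  rewrite (le_trans t0)// ln_ge0// ltW// ltNge order_stat_le// -ltnNge.
  rewrite (eq_count (a2 := pred0)) ?count_pred0; first by case/andP : i1n.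
  by move=> j /=; rewrite leNgt X1.
set p := 1 - expR (- s); set q := pareto_cdf alpha (expR t).
have qp : q < p by rewrite /q pareto_cdf_expR// ltrD2l ltrN2 ltr_expR ltrN2.
have p0 : 0 <= p.
  rewrite subr_ge0 -expR0 ler_expR oppr_le0 (le_trans _ (ltW ts))//.
  by rewrite mulr_ge0 ?ltW.
have e0 : 0 < (p - q) / 2 by rewrite divr_gt0// subr_gt0.
have := whp_empirical_cdf (expR t) e0.
apply: filterS => -[n w] /=; rewrite ltr_norml -/q => /andP[_ Nq] i i1n.
have /andP[_ lin] := i1n; rewrite plotting_position_gt// -/p => ip.
have ost : expR t < order_stat X n i w.
  rewrite ltNge order_stat_le// -ltnNge -(ltr_nat R).
  rewrite -natr1 in ip.
  have : 0 <= n%:R * ((p - q) / 2) by rewrite mulr_ge0// ltW.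
  nra.
by rewrite ltW// -[t]expRK ltr_ln ?posrE ?expR_gt0// (lt_trans _ ost) ?expR_gt0.
Qed.

End qq_plot_whp.

(** The convergence of the plots, as convergence in the Fell topology along the
    filter of statements that hold with high probability. *)
Lemma qq_plot_whp_cvg d (Omega : measurableType d) (R : realType)
    (P : probability Omega R) (alpha : R) (X : nat -> {RV P >-> R}) :
  0 < alpha -> mutually_independent X -> (forall i, pareto alpha (X i)) ->
  qq_plot X nw.1 nw.2 @[nw --> whp P] --> limit_line alpha.
Proof.
move=> a0 indepX paretoX.
have below := whp_qq_below a0 indepX paretoX.
have above := whp_qq_above a0 indepX paretoX.
apply: (@fell_cvg (R * R)%type (nat * Omega)%type (whp P)
  (fun nw => qq_plot X nw.1 nw.2) (limit_line alpha) _).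
- move=> [x y] /= xyL.
  (* A neighbourhood V of the point outside the line, and an event W of high
     probability on which the plot does not meet V. *)
  suff [V [W [Vxy VW]]] : exists V W, [/\ nbhs (x, y) V, whp P W &
      forall q nw, V q -> W nw -> ~ qq_points X nw.1 nw.2 q].
    move=> /= VWqq; exists (V, W) => //= -[q nw] [Vq Wnw]; exact: VWqq.
  have c1 : q.1 @[q --> (x, y)] --> x by exact: cvg_fst.
  have c2 : q.2 @[q --> (x, y)] --> y by exact: cvg_snd.
  have nb1 s : x < s -> \forall q \near (x, y), q.1 < s.
    by move=> xs; exact: (c1 [set z | z < s] (lt_nbhsl xs)).
  have nb1' s : s < x -> \forall q \near (x, y), s < q.1.
    by move=> xs; exact: (c1 [set z | s < z] (lt_nbhsr xs)).
  have nb2 s : y < s -> \forall q \near (x, y), q.2 < s.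
    by move=> xs; exact: (c2 [set z | z < s] (lt_nbhsl xs)).
  have nb2' s : s < y -> \forall q \near (x, y), s < q.2.
    by move=> xs; exact: (c2 [set z | s < z] (lt_nbhsr xs)).
  have [x0|x0] := ltP x 0.
    exists [set q | q.1 < 0], setT; split; [exact: nb1|exact: filterT|].
    move=> q [n w] /= q0 _ [i /andP[_ lin]] iq; move: q0; rewrite -iq/=.
    by rewrite ltNge plotting_position_ge0.
  have [yx|xy|yx] := ltgtP y (x / alpha); last by
    exfalso; apply: xyL; exists x => //; rewrite yx.
  (* The quadrant with corner (s, t), a point strictly between (x, y) and the
     line. *)
  + pose t := (y + x / alpha) / 2.
    have tx : alpha * t < x by rewrite mulrC -ltr_pdivlMr// /t; lra.
    pose s := (x + alpha * t) / 2.
    have ts : alpha * t < s by rewrite /s; lra.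
    exists ([set q | s < q.1] `&` [set q | q.2 < t]); eexists; split.
    * by apply: filterI;
        [apply: nb1'; rewrite /s; lra|apply: nb2; rewrite /t; lra].
    * exact: above ts.
    * move=> q [n w] /= [sq qt] h [i i1n] iq; move: sq qt; rewrite -iq/= => sq.
      by rewrite ltNge h.
  + pose t := (y + x / alpha) / 2.
    have tx : x < alpha * t by rewrite mulrC -ltr_pdivrMr// /t; lra.
    pose s := (x + alpha * t) / 2.
    have st : s < alpha * t by rewrite /s; lra.
    exists ([set q | q.1 < s] `&` [set q | t < q.2]); eexists; split.
    * by apply: filterI;
        [apply: nb1; rewrite /s; lra|apply: nb2'; rewrite /t; lra].
    * exact: below st.
    * move=> q [n w] /= [sq qt] h [i i1n] iq; move: sq qt; rewrite -iq/= => sq.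
      by rewrite ltNge h.
- move=> _ V [x /= x0 <-] /nbhs_ballP[e /= e0 eV].
  (* A point of the plot whose abscissa lies between x and x + del, with del so
     small that the comparisons place its ordinate within e / 2 of x / alpha. *)
  pose del := Num.min e (alpha * e / 4).
  have del0 : 0 < del by rewrite lt_min e0/= divr_gt0// mulr_gt0.
  have dele : del <= e by rewrite ge_min lexx.
  have dela : del <= alpha * e / 4 by rewrite ge_min lexx orbT.
  have ae : 0 < alpha * e by rewrite mulr_gt0.
  have ax : alpha * (x / alpha) = x by rewrite mulrC divfK ?gt_eqF.
  have st : x + del < alpha * (x / alpha + e / 2) by rewrite mulrDr ax; lra.
  have ts : alpha * (x / alpha - e / 2) < x by rewrite mulrBr ax; lra.
  have := whp_eventually P (@plotting_position_dense R x (x + del) x0 _).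
  rewrite ltrDl => /(_ del0).
  apply: filterS3 (below _ _ st) (above _ _ ts)
    => -[n w] /= bel abo [i i1n /andP[xi ix]].
  have {}bel := bel i i1n ix; have {}abo := abo i i1n xi.
  exists (- ln (1 - i%:R / n.+1%:R), ln (order_stat X n i w)); split.
    by exists i.
  by apply: eV; split; rewrite /ball/= ltr_distlC; apply/andP; split; lra.
Qed.

Unset Implicit Arguments.

Theorem corollary3p4 (R : realType) (d : measure_display)
    (Omega : measurableType d) (P : probability Omega R)
    (alpha : R) (halpha : 0 < alpha)
    (X : nat -> {RV P >-> R})
    (hindep : mutually_independent X)
    (hpareto : forall i : nat, pareto alpha (X i)) :
  (forall n : nat, random_closed_set (qq_plot X n)) /\
  (forall dF : fell (R * R)%type -> fell (R * R)%type -> R,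
     compatible_metric dF ->
     cvg_in_probability P dF (qq_plot X) (limit_line alpha)).
Proof.
have random n : random_closed_set (qq_plot X n).
  by apply: random_qq_plot => j; exact: measurable_funPT.
split=> // dF dFT; apply: whp_cvg_in_probability => //.
exact: qq_plot_whp_cvg.
Qed.
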